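(* Let $\Gamma$ be a finitely generated abelian group and let $F>1$ be an integer, acting on $\Gamma$ by multiplication. Then every $F$-subset of $\Gamma$ is $F$-automatic.
   Context: $F$-subsets: for $\Gamma$ a finitely generated abelian group with endomorphism $F$, an $F$-subset of $\Gamma$ is a finite union of finite set sums ($A+B=\{a+b: a\in A,b\in B\}$) of: singletons in $\Gamma$; $F$-invariant subgroups of $\Gamma$ (here, all subgroups); and $F$-cycles, i.e. sets $C(\gamma;\delta):=\{\gamma+F^\delta\gamma+F^{2\delta}\gamma+\cdots+F^{\ell\delta}\gamma:\ell\in\mathbb N\}$ with $\gamma\in\Gamma$, $\delta$ a positive integer ($0\in\mathbb N$). $F$-automatic sets (for an integer $F>1$, in the classical sense): a subset $S\subseteq\mathbb Z^d$ is $F$-automatic if there is a ($d$-dimensional) finite automaton which takes as inputs $d$-tuples of words of equal length on the alphabet $\{+,-,0,1,\dots,F-1\}$ (i.e. words on the alphabet $\{+,-,0,1,\dots,F-1\}^d$), and which accepts a $d$-tuple of words if and only if the words form the signed base-$F$ expansions (a sign followed by digits, padded with leading zeros as needed to have equal length) of the coordinates of an element of $S$. For a finitely generated abelian group $\Gamma$, a subset $S\subseteq\Gamma$ is $F$-automatic if for some (equivalently, any) $d$ and surjective homomorphism $f:\mathbb Z^d\to\Gamma$, the set $f^{-1}(S)$ is $F$-automatic in $\mathbb Z^d$. *)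

(* Defs.v *)
From HB Require Import structures.
From mathcomp Require Import all_boot all_order all_algebra.
From mathcomp Require Import boolp classical_sets.

Set Implicit Arguments.
Unset Strict Implicit.
Unset Printing Implicit Defensive.

Import GRing.Theory.
Local Open Scope classical_set_scope.
Local Open Scope ring_scope.

Definition finitely_generated (G : zmodType) : Prop :=
  exists m (X : m.-tuple G), forall x : G, inIntSpan X x.

Definition multiplication (F : nat) (G : zmodType) (x : G) : G := x *+ F.

Lemma multiplication_is_zmod_morphism (F : nat) (G : zmodType) :
  zmod_morphism (@multiplication F G).
Proof. by move=> x y; rewrite /multiplication mulrnBl. Qed.

HB.instance Definition _ (F : nat) (G : zmodType) :=
  GRing.isZmodMorphism.Build G G (@multiplication F G)
    (@multiplication_is_zmod_morphism F G).

Definition sumset (G : zmodType) (A B : set G) : set G :=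
  [set a + b | a in A & b in B].

Definition Fcycle (G : zmodType) (phi : {additive G -> G})
    (g : G) (delta : nat) : set G :=
  range (fun l : nat => \sum_(i < l.+1) iter (delta * i) phi g).

Variant Fset_summand (G : zmodType) (phi : {additive G -> G}) :
    set G -> Prop :=
  | Summand_singleton g : Fset_summand phi [set g]
  | Summand_subgroup (H : set G) of
      zmod_closed [in H] & phi @` H `<=` H : Fset_summand phi H
  | Summand_cycle g delta of (0 < delta)%N :
      Fset_summand phi (Fcycle phi g delta).

Definition Fsubset (G : zmodType) (phi : {additive G -> G}) (S : set G) :
    Prop :=
  exists2 Ass : seq (seq (set G)),
    {in Ass, forall As, {in As, forall A, Fset_summand phi A}}
  & S = \big[setU/set0]_(As <- Ass) \big[@sumset G/[set 0]]_(A <- As) A.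

Record dfa (L : Type) := Dfa {
  dfa_state : finType;
  dfa_init : dfa_state;
  dfa_trans : dfa_state -> L -> dfa_state;
  dfa_final : pred dfa_state }.

Definition dfa_accept (L : Type) (M : dfa L) (w : seq L) : bool :=
  dfa_final (foldl (@dfa_trans L M) (dfa_init M) w).

Variant symbol (F : nat) := Plus | Minus | Digit of 'I_F.

(* Most significant digit first; leading zeros are allowed. *)
Definition digits_value (F : nat) (ds : seq 'I_F) : nat :=
  foldl (fun n (c : 'I_F) => (n * F + c)%N) 0%N ds.

(* All padded expansions of an integer count as expansions of it; 0 may carry
   either sign and may have no digits at all. *)
Variant signed_expansion (F : nat) : seq (symbol F) -> int -> Prop :=
  | Expansion_plus ds :
      signed_expansion (Plus F :: map (@Digit F) ds) (digits_value ds)%:Z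
  | Expansion_minus ds :
      signed_expansion (Minus F :: map (@Digit F) ds) (- (digits_value ds)%:Z).

(* A d-tuple of words of equal length is encoded as one word whose letters are
   d-tuples of symbols. *)
Definition coord_word (F d : nat) (w : seq (d.-tuple (symbol F))) (i : 'I_d) :
    seq (symbol F) :=
  [seq tnth a i | a <- w].

Definition automaticZ (F d : nat) (S : set 'rV[int]_d) : Prop :=
  exists M : dfa (d.-tuple (symbol F)), forall w : seq (d.-tuple (symbol F)),
    dfa_accept M w <->
    exists2 v : 'rV[int]_d, S v &
      forall i : 'I_d, signed_expansion (coord_word w i) (v 0 i).

Definition automatic (F : nat) (G : zmodType) (S : set G) : Prop :=
  exists (d : nat) (f : {additive 'rV[int]_d -> G}),
    range f = setT /\ automaticZ F (f @^-1` S).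

(* Main.v *)
Require Import Defs.
From HB Require Import structures.
From mathcomp Require Import all_boot all_order all_algebra.
From mathcomp Require Import boolp classical_sets.
From mathcomp Require Import zify.

(** Call a subset of an abelian group self-similar when it belongs to a finite
    family of sets (A_i), each of which is a finite union of sets e + F A_j.
    In such a system e is a last digit and A_j the constraint on the remaining
    digits, except that e may be any group element, so that an element can
    have many expansions. This freedom makes the notion stable under sums for
    free, with no carries: (e + F A) + (e' + F B) = (e + e') + F (A + B)
    ([selfsimilarD]). Unions, singletons, cyclic subgroups and F-cycles
    ([selfsimilar_Fcycle]) are handled by writing down a system. A subgroup of
    Z^d is a finite sum of cyclic subgroups, by elimination of one coordinate
    at a time, hence is self-similar ([selfsimilar_subgroup]).

    Let f : Z^d -> G be surjective. Then f^-1 turns sums into sums and unions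
    into unions. The preimage of a subgroup is a subgroup, and the preimage of
    a singleton or cycle f(A) is A + ker f. So the preimage of an F-subset of
    G is self-similar ([selfsimilar_preimage_Fsubset]).

    It remains to see that a self-similar subset of Z^d is automatic
    ([selfsimilar_automaticZ]); here the carries appear. A vector F v + r, with
    r made of genuine signed digits, lies in A_i + c if and only if v lies in
    some A_j + c' with F c' = e + c - r and e + F A_j a piece of A_i. As
    F >= 2 the carries c stay in a fixed box. Thus membership of F v + r in
    the finitely many sets A_i + c is a function of r and of the membership of
    v in these sets. An automaton reading the most significant digit first
    only has to remember the signs and, for the vector v read so far, which of
    these sets contain v ([automaticZ_kernel]). *)

Set Implicit Arguments.
Unset Strict Implicit.
Unset Printing Implicit Defensive.

Import Order.TTheory GRing.Theory Num.Theory.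
Local Open Scope ring_scope.
Local Open Scope classical_set_scope.

(** * Self-similar sets *)

(** A pair [(e, j)] in [T i] stands for the piece e + F A_j of A_i. *)
Definition selfsimilar (F : nat) (G : zmodType) (S : set G) : Prop :=
  exists (I : finType) (A : I -> set G) (T : I -> seq (G * I)) (i0 : I),
    A i0 = S /\
    forall i x, A i x <->
      exists2 p, p \in T i & exists2 y, A p.2 y & x = p.1 + y *+ F.

Section Closure.
Variables (F : nat) (G : zmodType).
Implicit Types (A B S : set G) (g : G).

Lemma selfsimilar0 : selfsimilar F (set0 : set G).
Proof.
exists unit, (fun=> set0), (fun=> [::]), tt; split=> // i x.
by split=> // -[].
Qed.

(** The system {g} = g + F {0}, {0} = 0 + F {0}. *)
Lemma selfsimilar1 g : selfsimilar F [set g].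
Proof.
exists bool, (fun b => [set if b then g else 0]).
exists (fun b => [:: (if b then g else 0, false)]), true; split=> // b x.
split=> [->|[p]].
  exists (if b then g else 0, false); first by rewrite mem_head.
  by exists 0; rewrite // mul0rn addr0.
by rewrite inE => /eqP-> [y /= -> ->]; rewrite mul0rn addr0.
Qed.

(** The two systems are put side by side, and one more set, the union, has as
    pieces those of A and those of B. *)
Lemma selfsimilarU A B :
  selfsimilar F A -> selfsimilar F B -> selfsimilar F (A `|` B).
Proof.
move=> [I [X [T [i [XA XP]]]]] [J [Y [U [j [YB YP]]]]].
pose Z (k : option (I + J)) :=
  match k with None => A `|` B | Some (inl a) => X a | Some (inr b) => Y b end.
pose l (s : seq (G * I)) : seq (G * option (I + J)) :=
  [seq (p.1, Some (inl p.2)) | p <- s].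
pose r (s : seq (G * J)) : seq (G * option (I + J)) :=
  [seq (p.1, Some (inr p.2)) | p <- s].
pose V (k : option (I + J)) :=
  match k with
  | None => l (T i) ++ r (U j)
  | Some (inl a) => l (T a)
  | Some (inr b) => r (U b)
  end.
have lP s x : (exists2 p, p \in l s & exists2 y, Z p.2 y & x = p.1 + y *+ F) <->
    exists2 p, p \in s & exists2 y, X p.2 y & x = p.1 + y *+ F.
  split=> [[_ /mapP[p ps ->]] [y]|[p ps [y]]]; first by exists p => //; exists y.
  by exists (p.1, Some (inl p.2)); [apply: map_f ps | exists y].
have rP s x : (exists2 p, p \in r s & exists2 y, Z p.2 y & x = p.1 + y *+ F) <->
    exists2 p, p \in s & exists2 y, Y p.2 y & x = p.1 + y *+ F.
  split=> [[_ /mapP[p ps ->]] [y]|[p ps [y]]]; first by exists p => //; exists y.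
  by exists (p.1, Some (inr p.2)); [apply: map_f ps | exists y].
exists (option (I + J)%type), Z, V, None; split=> // -[[a|b]|] x /=.
- by rewrite XP -lP.
- by rewrite YP -rP.
rewrite -XA -YB /setU /= XP YP -lP -rP; split.
  by case=> -[p pV py]; exists p => //; rewrite mem_cat pV ?orbT.
by case=> p; rewrite mem_cat => /orP[] pV py; [left|right]; exists p.
Qed.

(** The sets A_i + B_j form a system, since
    (e + F A) + (e' + F B) = (e + e') + F (A + B). *)
Lemma selfsimilarD A B :
  selfsimilar F A -> selfsimilar F B -> selfsimilar F (sumset A B).
Proof.
move=> [I [X [T [i [XA XP]]]]] [J [Y [U [j [YB YP]]]]].
exists (I * J)%type, (fun k => sumset (X k.1) (Y k.2)).
exists (fun k => [seq (p.1 + q.1, (p.2, q.2)) | p <- T k.1, q <- U k.2]), (i, j).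
split=> [|k x] /=; first by rewrite XA YB.
split=> [[_ /XP[p pT [y yX ->]] [_ /YP[q qU [z zY ->]] <-]]|].
  exists (p.1 + q.1, (p.2, q.2)).
    by apply/allpairsP; exists (p, q).
  by exists (y + z); [exists y => //; exists z | rewrite mulrnDl addrACA].
case=> _ /allpairsP[[p q] /= [pT qU ->]] [_ [y yX [z zY <-]] /= ->].
exists (p.1 + y *+ F); first by apply/XP; exists p => //; exists y.
exists (q.1 + z *+ F); first by apply/YP; exists q => //; exists z.
by rewrite mulrnDl addrACA.
Qed.

(** Division of n by F gives Zg = (0 + F Zg) U (g + F Zg) U ... U
    ((F - 1)g + F Zg). *)
Lemma selfsimilar_cyclic g : (0 < F)%N ->
  selfsimilar F (range (fun n : int => g *~ n)).
Proof.
move=> F_gt0; exists unit, (fun=> range (fun n : int => g *~ n)).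
exists (fun=> [seq (g *+ s, tt) | s <- iota 0 F]), tt; split=> // _ x.
split=> [[n _ <-]|[_ /mapP[s _ ->] [_ [n _ <-] ->]]]; last first.
  by exists (s%:Z + n * F%:Z) => //; rewrite mulrzDr mulrzA.
have F0 : F%:Z != 0 by lia.
have := ltz_mod n F0; have := modz_ge0 n F0.
have := divz_eq n F%:Z; case: (n %% F)%Z => // s -> _ sF.
exists (g *+ s, tt); first by apply/mapP; exists s; rewrite // mem_iota; lia.
exists (g *~ (n %/ F)%Z); first by exists (n %/ F)%Z.
by rewrite mulrzDr mulrzA addrC.
Qed.

Lemma iter_multiplication n g : iter n (@multiplication F G) g = g *+ F ^ n.
Proof.
by elim: n => [|n IHn]; rewrite ?mulr1n //= IHn /multiplication -mulrnA -expnSr.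
Qed.

(** All terms but the first of a sum in a cycle have the common factor F^delta,
    and the quotients are again the terms of such a sum. *)
Lemma FcycleP g delta x : Fcycle (@multiplication F G) g delta x <->
  x = g \/ exists2 y, Fcycle (@multiplication F G) g delta y &
    x = g + y *+ F ^ delta.
Proof.
have sumS l : \sum_(i < l.+2) iter (delta * i) (@multiplication F G) g =
    g + (\sum_(i < l.+1) iter (delta * i) (@multiplication F G) g) *+ F ^ delta.
  rewrite big_ord_recl muln0 -sumrMnl; congr (_ + _); apply: eq_bigr => i _.
  by rewrite !iter_multiplication -mulrnA -expnD -mulnSr.
split=> [[[|l] _ <-]|[->|[_ [l _ <-] ->]]].
- by left; rewrite big_ord1 muln0.
- by right; rewrite sumS; eexists; first by exists l.
- by exists 0 => //; rewrite big_ord1 muln0.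
- by exists l.+1 => //; rewrite sumS.
Qed.

(** The system consists of {0} and of F^j C for j < delta: for j > 0 the set
    F^j C is 0 + F (F^(j-1) C), and C is (g + F {0}) U (g + F (F^(delta-1) C)). *)
Lemma selfsimilar_Fcycle g delta : (0 < delta)%N ->
  selfsimilar F (Fcycle (@multiplication F G) g delta).
Proof.
case: delta => // delta _; set C := Fcycle _ _ _.
pose A (k : option 'I_delta.+1) :=
  if k is Some j then [set y *+ F ^ j | y in C] else [set 0].
pose T (k : option 'I_delta.+1) : seq (G * option 'I_delta.+1) :=
  match k with
  | None => [:: (0, None)]
  | Some j => if j == 0 :> nat then [:: (g, None); (g, Some ord_max)]
              else [:: (0, Some (inord j.-1))]
  end.
exists (option 'I_delta.+1), A, T, (Some ord0); split.
  apply/seteqP; split=> [_ [y yC <-]|y yC] /=; first by rewrite mulr1n.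
  by exists y; rewrite ?mulr1n.
case=> [j|] x /=; last first.
  split=> [->|[p]]; last by rewrite inE => /eqP-> [_ -> ->]; rewrite mul0rn addr0.
  by exists (0, None); [rewrite mem_head | exists 0; rewrite // mul0rn addr0].
case: (posnP j) => [->|j_gt0].
  split=> [[_ /FcycleP[->|[y yC ->]] <-]|[p]].
  - exists (g, None); first by rewrite mem_head.
    by exists 0; rewrite // mul0rn addr0 mulr1n.
  - exists (g, Some ord_max); first by rewrite !inE eqxx orbT.
    by exists (y *+ F ^ delta); [exists y | rewrite -mulrnA -expnSr mulr1n].
  rewrite !inE => /orP[]/eqP-> [z /=].
    by move=> -> ->; exists g; rewrite ?mulr1n ?mul0rn ?addr0 //; apply/FcycleP; left.
  move=> [y yC <-] ->; exists (g + y *+ F ^ delta.+1); last first.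
    by rewrite mulr1n -mulrnA -expnSr.
  by apply/FcycleP; right; exists y.
have inordE : (inord j.-1 : 'I_delta.+1) = j.-1 :> nat.
  by rewrite inordK //; have := ltn_ord j; lia.
have powE y : y *+ F ^ j = 0 + y *+ F ^ (inord j.-1 : 'I_delta.+1) *+ F :> G.
  by rewrite inordE add0r -mulrnA -expnSr prednK.
split=> [[y yC <-]|[p]].
  exists (0, Some (inord j.-1)); first by rewrite mem_head.
  by exists (y *+ F ^ (inord j.-1 : 'I_delta.+1)); [exists y | exact: powE].
by rewrite inE => /eqP-> [_ [y yC <-] ->]; exists y; rewrite // powE.
Qed.

End Closure.

(** * Subgroups of Z^d *)

Section Subgroup.
Variables (F d : nat).
Hypothesis F_gt0 : (0 < F)%N.
Implicit Types (H : set 'rV[int]_d).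

Definition subgroup (G : zmodType) (H : set G) :=
  H 0 /\ forall x y, H x -> H y -> H (x - y).

Lemma subgroupMz (G : zmodType) (H : set G) x (n : int) :
  subgroup H -> H x -> H (x *~ n).
Proof.
move=> [H0 HB] Hx; have HN y : H y -> H (- y) by rewrite -sub0r; apply: HB.
have HM m : H (x *+ m).
  elim: m => [|m IHm]; first by rewrite mulr0n.
  by rewrite mulrSr -[x in _ + x]opprK; apply: HB => //; apply: HN.
by case: n => n; [apply: HM | apply/HN/HM].
Qed.

(** The j-th coordinates of the elements of H form a subgroup of Z, hence the
    multiples of one of them. *)
Lemma subgroup_coord_gen H (j : 'I_d) : subgroup H ->
  exists2 k, H k & forall v, H v -> exists n : int, v 0 j = k 0 j * n.
Proof.
move=> sgH; have [H0 HB] := sgH.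
have [[k Hk kj]|noH] := pselect (exists2 k, H k & k 0 j != 0); last first.
  exists 0 => // v Hv; exists 0; rewrite mulr0; apply/eqP; apply: contrapT.
  by move=> /negP vj; apply: noH; exists v.
pose P n := `[< exists v, [/\ H v, v 0 j != 0 & absz (v 0 j) = n] >].
have exP : exists n, P n by exists (absz (k 0 j)); apply/asboolP; exists k.
have [n /asboolP[{kj} k0 [{Hk} Hk kj <-]] kmin] := ex_minnP exP.
exists k0 => // v Hv; set q := divz (v 0 j) (k0 0 j).
have vE : v 0 j = q * k0 0 j + modz (v 0 j) (k0 0 j) := divz_eq _ _.
exists q; rewrite mulrC {1}vE -[RHS]addr0; congr (_ + _).
apply/eqP; apply: contraT => r0.
have wj : (v - k0 *~ q) 0 j = modz (v 0 j) (k0 0 j).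
  by rewrite !mxE -scaler_int mxE intz {1}vE addrAC subrr add0r.
have := kmin (absz (modz (v 0 j) (k0 0 j))); rewrite leqNgt => /(_ _)/negP[].
  apply/asboolP; exists (v - k0 *~ q); rewrite wj; split=> //.
  by apply: HB => //; apply: subgroupMz.
by have := ltz_mod (v 0 j) kj; have := modz_ge0 (v 0 j) kj; lia.
Qed.

(** Induction on a list s of coordinates outside of which H vanishes. If k in H
    generates the j-th coordinates of H, then H is the sum of Zk and of the
    subgroup of H where the j-th coordinate vanishes. *)
Lemma selfsimilar_subgroup H : subgroup H -> selfsimilar F H.
Proof.
suff [s] : exists s : seq 'I_d,
    forall v, H v -> forall i, i \notin s -> v 0 i = 0.
  elim: s H => [|j s IHs] H Hs sgH.
    suff -> : H = [set 0] by apply: selfsimilar1.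
    apply/seteqP; split=> [v Hv|_ ->]; last by case: sgH.
    by apply/rowP => i; rewrite mxE (Hs v Hv).
  have [k Hk kP] := subgroup_coord_gen j sgH; have [H0 HB] := sgH.
  have -> : H = sumset (range (fun n : int => k *~ n))
                       [set v | H v /\ v 0 j = 0].
    apply/seteqP; split=> [v Hv|_ [_ [n _ <-] [v [Hv _] <-]]]; last first.
      rewrite -[v]opprK; apply: (HB); first exact: subgroupMz.
      by rewrite -sub0r; apply: (HB).
    have [n vj] := kP v Hv; exists (k *~ n); first by exists n.
    exists (v - k *~ n); last by rewrite addrC subrK.
    split; first by apply: HB => //; apply: subgroupMz.
    by rewrite !mxE -scaler_int mxE intz vj mulrC subrr.
  apply: selfsimilarD; first exact: selfsimilar_cyclic.
  apply: IHs => [v [Hv vj] i i_s|].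
    by have [->//|ij] := eqVneq i j; apply: (Hs v Hv); rewrite inE negb_or ij.
  split=> [|x y [Hx xj] [Hy yj]]; first by split; rewrite ?mxE; case: sgH.
  by split; [case: sgH => _; apply | rewrite !mxE xj yj subrr].
by exists (enum 'I_d) => v _ i; rewrite mem_enum.
Qed.

End Subgroup.

(** * Signed expansions *)

Section Expansion.
Variable F : nat.
Implicit Types (b : bool) (u : seq (symbol F)) (s : symbol F).

Definition sign_symbol b := if b then Minus F else Plus F.

Definition sign_of s : option bool :=
  match s with Plus => Some false | Minus => Some true | Digit _ => None end.

Definition digit_of s : option nat :=
  if s is Digit c then Some (c : nat) else None.

Definition expands b u (x : int) : Prop :=
  exists2 ds : seq 'I_F, u = sign_symbol b :: map (@Digit F) ds &
    x = (-1) ^+ b * (digits_value ds)%:Z.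

Lemma signed_expansionP u x : signed_expansion u x <-> exists b, expands b u x.
Proof.
split=> [[] ds|[b [ds -> ->]]].
- by exists false, ds; rewrite // mul1r.
- by exists true, ds; rewrite // mulN1r.
by case: b; rewrite ?mulN1r ?mul1r; constructor.
Qed.

Lemma digits_value_rcons (ds : seq 'I_F) c :
  digits_value (rcons ds c) = (digits_value ds * F + c)%N.
Proof. exact: foldl_rcons. Qed.

Lemma expands_nil b : expands b [:: sign_symbol b] 0.
Proof. by exists [::]; rewrite // mulr0. Qed.

Lemma expands_rcons b u x c :
  expands b u x -> expands b (rcons u (Digit c))
    (x *+ F + (-1) ^+ b * (c : nat)%:Z).
Proof.
move=> [ds -> ->]; exists (rcons ds c); first by rewrite map_rcons.
by rewrite digits_value_rcons PoszD PoszM mulrDr -[_ *+ F]mulr_natr natz mulrA.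
Qed.

Lemma signed_expansion_inj u x y :
  signed_expansion u x -> signed_expansion u y -> x = y.
Proof.
have Dinj : injective (@Digit F) by move=> c c' [].
move=> /signed_expansionP[b [ds -> ->]] /signed_expansionP[b' [ds' [] bb' + ->]].
by move/(inj_map Dinj) => ->; case: b b' bb' => [] [].
Qed.

Lemma signed_expansion1 s x : signed_expansion [:: s] x -> sign_of s.
Proof. by move=> /signed_expansionP[[] [ds [-> _]]]. Qed.

Lemma signed_expansion_rcons u s x :
  u <> [::] -> signed_expansion (rcons u s) x ->
  digit_of s /\ exists y, signed_expansion u y.
Proof.
move=> u0 /signed_expansionP[b [ds]].
case: u u0 => // t u _ [] -> us _; case/lastP: ds us => [|ds c].
  by move/(congr1 size); rewrite size_rcons.
rewrite map_rcons => /rcons_inj[-> ->]; split=> //.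
by exists ((-1) ^+ b * (digits_value ds)%:Z); apply/signed_expansionP; exists b, ds.
Qed.

End Expansion.

(** * From finite kernels to automata *)

Section Automaton.
Variables (F d : nat) (J : finType) (B : J -> set 'rV[int]_d.+1).
Variables (R : J -> 'rV[int]_d.+1 -> J -> Prop).
(* Membership of F v + r in the sets B_j only depends on r and on the
   membership of v in these sets. *)
Hypothesis BP : forall j (v r : 'rV[int]_d.+1),
  (forall k, (absz (r 0%R k) < F)%N) ->
  B j (v *+ F + r) <-> exists2 j', R j r j' & B j' v.

Let letter := d.+1.-tuple (symbol F).

Definition membership (v : 'rV[int]_d.+1) : {ffun J -> bool} :=
  [ffun j => `[< B j v >]].

Definition digit_vector (e : {ffun 'I_d.+1 -> bool}) (a : letter) :
    'rV[int]_d.+1 :=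
  \row_k ((-1) ^+ e k * (odflt 0%N (digit_of (tnth a k)))%:Z).

(** [Read e q] is reached once the signs e and the digits of a vector v have
    been read, with q = [membership v]. *)
Variant state :=
  Start | Dead | Read of {ffun 'I_d.+1 -> bool} & {ffun J -> bool}.

Definition state_code (s : state) :=
  match s with
  | Start => None | Dead => Some None | Read e q => Some (Some (e, q))
  end.
Definition state_decode c :=
  match c with
  | None => Start | Some None => Dead | Some (Some (e, q)) => Read e q
  end.
Lemma state_codeK : cancel state_code state_decode. Proof. by case. Qed.
HB.instance Definition _ := Finite.copy state (can_type state_codeK).

Definition membership_step (q : {ffun J -> bool}) (r : 'rV[int]_d.+1) :
    {ffun J -> bool} :=
  [ffun j => [exists j', `[< R j r j' >] && q j']].

Definition trans (s : state) (a : letter) : state :=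
  match s with
  | Start => if [forall k, sign_of (tnth a k)] then
      Read [ffun k => odflt false (sign_of (tnth a k))] (membership 0) else Dead
  | Dead => Dead
  | Read e q => if [forall k, digit_of (tnth a k)] then
      Read e (membership_step q (digit_vector e a)) else Dead
  end.

Lemma membershipD (v r : 'rV[int]_d.+1) : (forall k, (absz (r 0%R k) < F)%N) ->
  membership (v *+ F + r) = membership_step (membership v) r.
Proof.
move=> rF; apply/ffunP => j; rewrite !ffunE; apply/asboolP/existsP => [/(BP j v rF)|].
  by move=> [j' jj' vj']; exists j'; rewrite ffunE; apply/andP; split; apply/asboolP.
move=> [j']; rewrite ffunE => /andP[/asboolP jj' /asboolP vj'].
by apply/(BP j v rF); exists j'.
Qed.

Definition tracks (w : seq letter) (s : state) : Prop :=
  match s with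
  | Start => w = [::]
  | Dead => w <> [::] /\
      ~ exists v : 'rV[int]_d.+1,
        forall i, signed_expansion (coord_word w i) (v 0 i)
  | Read e q => exists2 v : 'rV[int]_d.+1, q = membership v &
      forall i, expands (e i) (coord_word w i) (v 0 i)
  end.

(** A letter r read after v leads to F v + r; a word stays without expansion
    when letters are appended, unless it is empty. *)
Lemma tracks_foldl w : tracks w (foldl trans Start w).
Proof.
elim/last_ind: w => // w a; rewrite foldl_rcons.
have wa0 : rcons w a <> [::] by case: w.
have wa i : coord_word (rcons w a) i = rcons (coord_word w i) (tnth a i).
  exact: map_rcons.
have nonnil i : w <> [::] -> coord_word w i <> [::] by case: w {wa0 wa}.
case: (foldl _ _ _) => [w0|[w0 noexp]|e q [v -> vw]] /=.
- case: forallP => [sgn|nosgn] /=.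
    exists 0 => // i; rewrite wa w0 ffunE mxE /=.
    by case: (tnth a i) (sgn i) => //= _; apply: expands_nil.
  split=> // -[v vwa]; apply: nosgn => i; have := vwa i.
  by rewrite wa w0; apply: signed_expansion1.
- split=> // -[v vwa]; apply: noexp.
  have [i|y yw] := @choice _ _ (fun i y => signed_expansion (coord_word w i) y).
    have := vwa i; rewrite wa => /signed_expansion_rcons[]; last by [].
    exact: nonnil.
  by exists (\row_i y i) => i; rewrite mxE.
have w0 : w <> [::].
  by move=> w0; have [ds] := vw ord0; rewrite w0.
case: forallP => [dig|nodig] /=.
  have rF k : (absz (digit_vector e a 0%R k) < F)%N.
    rewrite mxE abszMsign; case: (tnth a k) (dig k) => //= c _; exact: ltn_ord.
  exists (v *+ F + digit_vector e a); first by rewrite membershipD.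
  move=> i; rewrite wa 2!mxE mulmxnE.
  by case: (tnth a i) (dig i) => //= c _; apply: expands_rcons.
split=> // -[x xwa]; apply: nodig => i; have := xwa i; rewrite wa.
by case/signed_expansion_rcons => //; apply: nonnil.
Qed.

(** A word determines the vector it expands, so that the vector found by
    [tracks_foldl] is the one whose membership has to be decided. *)
Lemma automaticZ_kernel j0 : automaticZ F (B j0).
Proof.
exists (Dfa Start trans (fun s => if s is Read _ q then q j0 else false)) => w.
rewrite /dfa_accept /=; have := tracks_foldl w.
case: (foldl _ _ _) => [->|[_ noexp]|e q [v -> vw]] /=.
- by split=> // -[v _ /(_ ord0)] /signed_expansionP[b []].
- by split=> // -[v _ vw]; case: noexp; exists v.
have vwS i : signed_expansion (coord_word w i) (v 0 i).
  by apply/signed_expansionP; exists (e i).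
rewrite ffunE; split=> [/asboolP vB|[x xB xw]]; first by exists v.
apply/asboolP; suff -> : v = x by [].
by apply/rowP => i; apply: signed_expansion_inj (vwS i) (xw i).
Qed.

End Automaton.

(** The automaton tracks membership in the translates A_i + c. If E bounds the
    coordinates of all e in the system, a carry c' with F c' = e + c - r has
    coordinates at most (E + M + F) / F, which is at most M for M = E + F. *)
Lemma selfsimilar_automaticZ F d (S : set 'rV[int]_d.+1) :
  (1 < F)%N -> selfsimilar F S -> automaticZ F S.
Proof.
move=> F_gt1 [I [A [T [i0 [<- AP]]]]].
have [E EP] : exists E, forall i p k, p \in T i -> (absz (p.1 0%R k) <= E)%N.
  exists (\max_i \max_(p <- T i) \max_k absz (p.1 0%R k)) => i p k pT.
  apply: leq_trans (leq_bigmax i); apply: leq_trans (leq_bigmax_seq _ pT _) => //.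
  exact: (leq_bigmax k).
pose M := (E + F)%N.
(* Vectors with coordinates in [-M, M], as a finite type. *)
pose carry (f : {ffun 'I_d.+1 -> 'I_(M + M).+1}) : 'rV[int]_d.+1 :=
  \row_k ((f k : nat)%:Z - M%:Z).
have carry_le f k : (absz (carry f 0%R k) <= M)%N.
  by rewrite mxE; have := ltn_ord (f k); lia.
have carry_surj (c : 'rV[int]_d.+1) :
      (forall k, (absz (c 0%R k) <= M)%N) -> exists f, carry f = c.
  move=> cM; exists [ffun k => inord (absz (c 0 k + M%:Z))].
  by apply/rowP => k; have ck := cM k; rewrite mxE ffunE inordK; lia.
have [f0 f0E] := carry_surj 0 (fun k => ltac:(by rewrite mxE)).
pose B (j : I * {ffun 'I_d.+1 -> 'I_(M + M).+1}) :=
    [set v | A j.1 (v - carry j.2)].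
have -> : A i0 = B (i0, f0).
  by apply/seteqP; split=> v; rewrite /B /= f0E subr0.
pose R (j : I * {ffun 'I_d.+1 -> 'I_(M + M).+1}) (r : 'rV[int]_d.+1)
    (j' : I * {ffun 'I_d.+1 -> 'I_(M + M).+1}) :=
  exists2 e, (e, j'.1) \in T j.1 & carry j'.2 *+ F = e + carry j.2 - r.
apply: (@automaticZ_kernel _ _ _ B R) => -[i f] v r rF; rewrite /B /R /=; split.
  move=> /AP[[e j] pT [y yA /= vE]].
  have cE : (v - y) *+ F = e + carry f - r.
    apply/eqP; rewrite mulrnBl subr_eq addrAC -subr_eq opprK addrAC -subr_eq.
    by rewrite vE.
  have [k|f' f'E] := carry_surj (v - y).
    have := EP i _ k pT; have := carry_le f k; have := rF k.
    have := congr1 (fun c : 'rV_d.+1 => c 0%R k) cE.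
    rewrite mulmxnE !mxE -mulr_natr natz /M /=; nia.
  exists (j, f') => /=; first by exists e; rewrite ?f'E.
  by rewrite f'E subKr.
move=> [[j f'] /= [e pT cE] vA]; apply/AP; exists (e, j) => //.
exists (v - carry f') => //=; rewrite mulrnBl cE; apply: (addrI (- e)).
by rewrite addKr opprB opprD addrC !addrA addrAC.
Qed.

(** * F-subsets of a finitely generated group *)

(** Surjectivity lets a decomposition of f x lift to one of x. *)
Lemma preimage_sumset (G H : zmodType) (f : {additive G -> H}) (A B : set H) :
  range f = setT ->
  f @^-1` sumset A B = sumset (f @^-1` A) (f @^-1` B).
Proof.
move=> fT; apply/seteqP; split=> [x [a aA [b bB abE]]|_ [x xA [y yB <-]]]; last first.
  by rewrite /= raddfD; exists (f x) => //; exists (f y).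
have [y _ ya] : range f a by rewrite fT.
exists y; first by rewrite /= ya.
by exists (x - y); rewrite /= ?raddfB ?ya -?abE ?[a + b]addrC ?addrK // addrC subrK.
Qed.

Lemma preimage_image (G H : zmodType) (f : {additive G -> H}) (A : set G) :
  f @^-1` (f @` A) = sumset A (f @^-1` [set 0]).
Proof.
apply/seteqP; split=> [x [a aA fax]|_ [a aA [b b0 <-]]].
  by exists a => //; exists (x - a); rewrite /= ?raddfB ?fax ?subrr // addrC subrK.
by exists a => //; rewrite raddfD (b0 : f b = 0) addr0.
Qed.

(** One coordinate more than there are generators is used, and is mapped to 0,
    so that the dimension is positive: in dimension 0 the empty word, which is
    not a signed expansion, would belong to the language of a nonempty set. *)
Lemma finitely_generated_surj (G : zmodType) : finitely_generated G ->
  exists (d : nat) (f : {additive 'rV[int]_d.+1 -> G}), range f = setT.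
Proof.
move=> [m [X XG]].
pose f (v : 'rV[int]_m.+1) : G := \sum_(i < m.+1) X`_i *~ v 0 i.
have fB : zmod_morphism f.
  by move=> v w; rewrite -sumrB; apply: eq_bigr => i _; rewrite !mxE mulrzBr.
pose fA := GRing.isZmodMorphism.Build _ _ f fB.
exists m, (HB.pack_for {additive 'rV[int]_m.+1 -> G} f fA).
apply/seteqP; split=> // x _.
have [a ->] := XG x; exists (\row_i oapp a 0 (insub (i : nat))) => //=.
rewrite /f big_ord_recr /= nth_default ?size_tuple // mul0rz addr0.
by apply: eq_bigr => i _; rewrite mxE /= valK.
Qed.

Section Preimages.
Variables (F d : nat) (G : zmodType) (f : {additive 'rV[int]_d -> G}).
Hypotheses (F_gt0 : (0 < F)%N) (fT : range f = setT).

Lemma subgroup_preimage (H : set G) : subgroup H -> subgroup (f @^-1` H).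
Proof.
move=> [H0 HB]; split=> [|x y Hx Hy]; first by rewrite /= raddf0.
by rewrite /= raddfB; apply: HB.
Qed.

Lemma selfsimilar_ker : selfsimilar F (f @^-1` [set 0]).
Proof.
apply: selfsimilar_subgroup => //; apply: subgroup_preimage.
by split=> // _ _ -> ->; rewrite /= subr0.
Qed.

Lemma selfsimilar_preimage_image A :
  selfsimilar F A -> selfsimilar F (f @^-1` (f @` A)).
Proof. by rewrite preimage_image => /selfsimilarD; apply; apply: selfsimilar_ker. Qed.

Lemma image_Fcycle g delta :
  f @` Fcycle (@multiplication F _) g delta =
    Fcycle (@multiplication F G) (f g) delta.
Proof.
have fsum l : f (\sum_(i < l.+1) iter (delta * i) (@multiplication F _) g) =
    \sum_(i < l.+1) iter (delta * i) (@multiplication F G) (f g).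
  by rewrite raddf_sum; apply: eq_bigr => i _; rewrite !iter_multiplication raddfMn.
apply/seteqP; split=> [_ [_ [l _ <-] <-]|_ [l _ <-]]; first by exists l; rewrite ?fsum.
by rewrite -fsum; eexists; first by exists l.
Qed.

Lemma selfsimilar_preimage_summand A :
  Fset_summand (@multiplication F G) A -> selfsimilar F (f @^-1` A).
Proof.
have flift g : exists a, f a = g.
  by have [a _ <-] : range f g; [rewrite fT | exists a].
case=> [g|H [H0 HB] _|g delta delta_gt0].
- have [a <-] := flift g; rewrite -image_set1.
  exact/selfsimilar_preimage_image/selfsimilar1.
- apply: selfsimilar_subgroup => //; apply: subgroup_preimage; split.
    exact/set_mem/H0.
  by move=> x y Hx Hy; apply/set_mem/HB; apply/mem_set.
- have [a <-] := flift g; rewrite -image_Fcycle.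
  exact/selfsimilar_preimage_image/selfsimilar_Fcycle.
Qed.

Lemma selfsimilar_preimage_Fsubset S :
  Fsubset (@multiplication F G) S -> selfsimilar F (f @^-1` S).
Proof.
move=> [Ass AssP ->]; elim: Ass AssP => [|As Ass IHAss] AssP.
  by rewrite big_nil preimage_set0; apply: selfsimilar0.
rewrite big_cons preimage_setU; apply: selfsimilarU; last first.
  by apply: IHAss => B BAss; apply: AssP; rewrite inE BAss orbT.
have {AssP} : {in As, forall A, Fset_summand (@multiplication F G) A}.
  by apply: AssP; rewrite mem_head.
elim: As => [|A As IHAs] AsP; first by rewrite big_nil; apply: selfsimilar_ker.
rewrite big_cons preimage_sumset //; apply: selfsimilarD.
  by apply: selfsimilar_preimage_summand; apply: AsP; rewrite mem_head.
by apply: IHAs => B BAs; apply: AsP; rewrite inE BAs orbT.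
Qed.

End Preimages.

Theorem theorem4p2 (G : zmodType) (F : nat) (S : set G) :
  finitely_generated G -> (1 < F)%N ->
  Fsubset (@multiplication F G) S -> automatic F S.
Proof.
move=> /finitely_generated_surj[d [f fT]] F_gt1 FS; exists d.+1, f; split=> //.
apply: selfsimilar_automaticZ => //.
by apply: selfsimilar_preimage_Fsubset => //; apply: ltnW.
Qed.
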